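(* For all complex numbers $q,x$ with $|q|<1$, \begin{align*} \sum_{i,j,k\ge 0}\frac{q^{(i+j)^2+(j+k)^2+k^2+j}x^{i+2j+2k}}{(q;q)_i(q^2;q^2)_j(q^2;q^2)_k}&=\sum_{i,j,k\ge 0}\frac{q^{i^2+(i+j)^2+(i+j+k)^2}x^{3i+2j+k}}{(q;q)_i(q;q)_j(q;q)_k},\\ \sum_{i,j,k\ge 0}\frac{q^{(i+j)^2+(j+k)^2+k^2+j+2k}x^{i+2j+2k}}{(q;q)_i(q^2;q^2)_j(q^2;q^2)_k}&=\sum_{i,j,k\ge 0}\frac{q^{i^2+(i+j)^2+(i+j+k)^2+2i+j}x^{3i+2j+k}}{(q;q)_i(q;q)_j(q;q)_k}. \end{align*}
   Context: Notation: for $n\in\mathbb{Z}_{\ge 0}$, $(a;p)_n=\prod_{k=0}^{n-1}(1-ap^k)$. Sums are over nonnegative integers. *)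

(* Defs.v *)
From HB Require Import structures.
From mathcomp Require Import all_boot all_order all_algebra.
From mathcomp Require Import all_classical all_reals all_analysis.
From mathcomp Require Import complex.
From mathcomp.analysis.showcase Require Import summability.
Set Implicit Arguments.
Unset Strict Implicit.
Unset Printing Implicit Defensive.
Import Order.TTheory GRing.Theory Num.Theory.
Import numFieldNormedType.Exports.

#[global] Open Scope classical_set_scope.
#[global] Open Scope complex_scope.
#[global] Open Scope ring_scope.

Definition qpoch (A : pzRingType) (a p : A) (n : nat) : A :=
  \prod_(k < n) (1 - a * p ^+ k).

(* The regular module [R[i]^o] carries the norm topology of [R[i]]. *)
Definition uncurry3 (R : realType) (F : nat -> nat -> nat -> R[i])
    (t : nat * nat * nat) : R[i]^o :=
  F t.1.1 t.1.2 t.2.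

(* Convergence along the net of finite subsets of nat^3, that is, unconditional
   convergence; in R[i] this is the same as absolute convergence. *)
Definition summable3 (R : realType) (F : nat -> nat -> nat -> R[i]) : Prop :=
  cvg (partial_sum (uncurry3 F) @ totally).

Definition sum3 (R : realType) (F : nat -> nat -> nat -> R[i]) : R[i] :=
  sum (uncurry3 F).

(* [lim] takes a default value on divergent nets, so an equality of sums is
   meaningful only together with the convergence of both. *)
Definition eq_sum3 (R : realType) (F G : nat -> nat -> nat -> R[i]) : Prop :=
  [/\ summable3 F, summable3 G & sum3 F = sum3 G].

(* Main.v *)
Require Import Defs.
From mathcomp Require Import all_boot all_order all_algebra.
From mathcomp Require Import finmap.
From mathcomp Require Import all_classical all_reals all_analysis.
From mathcomp Require Import complex.
From mathcomp.analysis.showcase Require Import summability.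
From mathcomp Require Import zify lra ring.

(** Both sides are power series in [x], and the identities hold coefficient by
    coefficient.  Write
      H(a,b,c) = sum q^((i+j)^2+(j+k)^2+k^2+ai+bj+ck) x^(i+2j+2k)
                 / ((q;q)_i (q^2;q^2)_j (q^2;q^2)_k),
      F(a,b,c) = sum q^(i^2+(i+j)^2+(i+j+k)^2+ai+bj+ck) x^(3i+2j+k)
                 / ((q;q)_i (q;q)_j (q;q)_k).
    The claims are H(0,1,0) = F(0,0,0) and H(0,1,2) = F(2,1,0).  For
    (u,v) = (H(0,1,0), H(0,1,2)) as well as for (u,v) = (F(0,0,0), F(2,1,0)),
      v(x) - u(xq) = xq u(xq) - x^4 q^7 u(xq^3),
      u(x) - v(x)  = x^2 q^2 v(xq) + x^3 q^3 u(xq^2),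
    ([hterm_qsystem], [fterm_qsystem]).  On coefficients of x^n this gives
    (1 - q^n) u_n and then v_n in terms of earlier coefficients, so a solution
    is determined by u_0 = 1 ([qsystem_uniq]).

    All relations come from one observation: raising the linear exponent a to
    a+1 multiplies a summand by q^i, the factor 1 - q^i cancels the last factor
    of (q;q)_i, and i can be replaced by i+1.  Thus, for instance,
      H(a,b,c) - H(a+1,b,c) = x q^(a+1) H(a+2,b+2,c),
      F(a,b,c) - F(a+1,b,c) = x^3 q^(a+3) F(a+6,b+4,c+2),
    and likewise for j and k.  Finitely many such relations suffice for H.  For
    F they yield the required relations only modulo the same relations
    multiplied by a power of x, so these are proved by induction on the order
    in x ([fterm_rec_jk], [fterm_rec_ijk]).

    As for convergence, a summand is bounded by a constant times
    2^-(i+j+k), because r^(n^2) K^n = O(2^-n) when 0 <= r < 1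
    ([gauss_le_geometric]).  Unconditional convergence follows, and each sum is
    then the limit of its partial sums over the finite sets of indices whose
    degree in x is less than N; those agree by the equality of coefficients. *)

Set Implicit Arguments.
Unset Strict Implicit.
Unset Printing Implicit Defensive.
Import Order.TTheory GRing.Theory Num.Theory.
Import numFieldNormedType.Exports.
Local Open Scope classical_set_scope.
Local Open Scope complex_scope.
Local Open Scope ring_scope.

(** * Coefficients of triple power series *)

(** The coefficient of x^n in x^w * sum_{i,j,k} T i j k * x^(d i j k).  The
    indices run below [M]; this loses nothing for [n < M] when every index is at
    most the degree [d].  The offset [w] expresses multiplication by x^w without
    any subtraction on exponents. *)
Definition xcoef (K : fieldType) (M : nat) (d : nat -> nat -> nat -> nat)
    (T : nat -> nat -> nat -> K) (w n : nat) : K :=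
  \sum_(i < M) \sum_(j < M) \sum_(k < M)
    if (w + d i j k == n)%N then T i j k else 0.

Lemma sum_ord_shift (V : zmodType) (f : nat -> V) M :
  f 0%N = 0 -> f M = 0 -> \sum_(i < M) f i = \sum_(i < M) f i.+1.
Proof.
move=> f0 fM; have : \sum_(i < M.+1) f i = \sum_(i < M.+1) f i by [].
by rewrite {1}big_ord_recr big_ord_recl /= f0 fM addr0 add0r.
Qed.

Section Coefficients.
Variables (K : fieldType) (M : nat) (d : nat -> nat -> nat -> nat).
Implicit Types (S T U : nat -> nat -> nat -> K).
Local Notation X := (@xcoef K M d).

Lemma eq_xcoef S T w n :
  (forall i j k, S i j k = T i j k) -> X S w n = X T w n.
Proof.
move=> eST; apply: eq_bigr => i _; apply: eq_bigr => j _.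
by apply: eq_bigr => k _; rewrite eST.
Qed.

Lemma xcoef_gt T w n : (n < w)%N -> X T w n = 0.
Proof.
move=> ltnw; apply: big1 => i _; apply: big1 => j _; apply: big1 => k _.
by rewrite gtn_eqF // ltn_addr.
Qed.

Lemma xcoefZ c T w n : X (fun i j k => c * T i j k) w n = c * X T w n.
Proof.
rewrite mulr_sumr; apply: eq_bigr => i _; rewrite mulr_sumr; apply: eq_bigr => j _.
by rewrite mulr_sumr; apply: eq_bigr => k _; case: ifP; rewrite ?mulr0.
Qed.

Lemma xcoefB S T w n :
  X (fun i j k => S i j k - T i j k) w n = X S w n - X T w n.
Proof.
rewrite -sumrB; apply: eq_bigr => i _; rewrite -sumrB; apply: eq_bigr => j _.
by rewrite -sumrB; apply: eq_bigr => k _; case: ifP; rewrite ?subr0.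
Qed.

(** The factor [q ^+ (m * d i j k)] amounts to substituting x q^m for x. *)
Lemma xcoef_qshift q m T w n :
  X (fun i j k => q ^+ (m * d i j k) * T i j k) w n
  = if (w <= n)%N then q ^+ (m * (n - w)) * X T 0 (n - w) else 0.
Proof.
case: leqP => [lewn|/xcoef_gt -> //]; rewrite -xcoefZ.
apply: eq_bigr => i _; apply: eq_bigr => j _; apply: eq_bigr => k _.
by rewrite -{1}(subnKC lewn) eqn_add2l add0n; case: eqP => [->|].
Qed.

(** If [S - T] vanishes at index 0 and equals [c * U] after a shift of the index
    that raises the degree by [a], then the series of [S] minus that of [T] is
    c x^a times that of [U]. *)
Lemma xcoefB_shift1 c S T U a w n :
  (n < M)%N -> (forall i j k, (i <= d i j k)%N) ->
  (forall i j k, d i.+1 j k = a + d i j k)%N ->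
  (forall j k, S 0%N j k = T 0%N j k) ->
  (forall i j k, S i.+1 j k - T i.+1 j k = c * U i j k) ->
  X S w n - X T w n = c * X U (w + a) n.
Proof.
move=> ltnM led dS ST0 STS; rewrite -xcoefB -xcoefZ.
(* The summand at i = M has degree at least M > n, so the shift loses nothing. *)
rewrite /xcoef (sum_ord_shift (f := fun i => \sum_(j < M) \sum_(k < M)
  if (w + d i j k == n)%N then S i j k - T i j k else 0)).
- apply: eq_bigr => i _; apply: eq_bigr => j _; apply: eq_bigr => k _.
  by rewrite dS addnA STS.
- by apply: big1 => j _; apply: big1 => k _; rewrite ST0 subrr if_same.
- apply: big1 => j _; apply: big1 => k _; rewrite gtn_eqF //.
  by rewrite (leq_trans ltnM) // (leq_trans (led _ j k)) ?leq_addl.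
Qed.
End Coefficients.

Lemma xcoef_swap12 (K : fieldType) (M : nat) (d : nat -> nat -> nat -> nat)
    (T : nat -> nat -> nat -> K) w n :
  xcoef M d T w n = xcoef M (fun i j k => d j i k) (fun i j k => T j i k) w n.
Proof. exact: exchange_big. Qed.

Lemma xcoefB_shift2 (K : fieldType) (M : nat) (d : nat -> nat -> nat -> nat) c
    (S T U : nat -> nat -> nat -> K) a w n :
  (n < M)%N -> (forall i j k, (j <= d i j k)%N) ->
  (forall i j k, d i j.+1 k = a + d i j k)%N ->
  (forall i k, S i 0%N k = T i 0%N k) ->
  (forall i j k, S i j.+1 k - T i j.+1 k = c * U i j k) ->
  xcoef M d S w n - xcoef M d T w n = c * xcoef M d U (w + a) n.
Proof.
move=> ltnM led dS ST0 STS.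
rewrite (@xcoef_swap12 _ _ d S) (@xcoef_swap12 _ _ d T) (@xcoef_swap12 _ _ d U).
by apply: xcoefB_shift1.
Qed.

Lemma xcoef_swap23 (K : fieldType) (M : nat) (d : nat -> nat -> nat -> nat)
    (T : nat -> nat -> nat -> K) w n :
  xcoef M d T w n = xcoef M (fun i j k => d i k j) (fun i j k => T i k j) w n.
Proof. by apply: eq_bigr => i _; exact: exchange_big. Qed.

Lemma xcoefB_shift3 (K : fieldType) (M : nat) (d : nat -> nat -> nat -> nat) c
    (S T U : nat -> nat -> nat -> K) a w n :
  (n < M)%N -> (forall i j k, (k <= d i j k)%N) ->
  (forall i j k, d i j k.+1 = a + d i j k)%N ->
  (forall i j, S i j 0%N = T i j 0%N) ->
  (forall i j k, S i j k.+1 - T i j k.+1 = c * U i j k) ->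
  xcoef M d S w n - xcoef M d T w n = c * xcoef M d U (w + a) n.
Proof.
move=> ltnM led dS ST0 STS.
rewrite (@xcoef_swap23 _ _ d S) (@xcoef_swap23 _ _ d T) (@xcoef_swap23 _ _ d U).
by apply: xcoefB_shift2.
Qed.

Lemma xcoef00 (K : fieldType) (M : nat) (d : nat -> nat -> nat -> nat)
    (T : nat -> nat -> nat -> K) :
  (forall i j k, (i + j + k <= d i j k)%N) -> d 0 0 0 = 0%N ->
  (0 < M)%N -> xcoef M d T 0 0 = T 0%N 0%N 0%N.
Proof.
case: M => [//|M'] led d0 _; rewrite /xcoef.
have z i j k : (0 < i + j + k)%N ->
    (if (0 + d i j k == 0)%N then T i j k else 0) = 0.
  by move=> p; rewrite gtn_eqF // (leq_trans p).
rewrite big_ord_recl [X in _ + X]big1 ?addr0 => [|i _]; last first.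
  by apply: big1 => j _; apply: big1 => k _; exact: z.
rewrite big_ord_recl [X in _ + X]big1 ?addr0 => [|j _]; last first.
  by apply: big1 => k _; exact: z.
rewrite big_ord_recl [X in _ + X]big1 ?addr0 => [|k _]; last exact: z.
by rewrite /= d0.
Qed.

(** * A q-difference system with a unique solution *)

(** The coefficients of x^w * sum_l u_l x^l. *)
Definition off (K : fieldType) (w : nat) (u : nat -> K) (n : nat) : K :=
  if (w <= n)%N then u (n - w)%N else 0.

(** The coefficients below x^M of the q-difference system
    v(x) - u(xq) = xq u(xq) - x^4 q^7 u(xq^3),
    u(x) - v(x) = x^2 q^2 v(xq) + x^3 q^3 u(xq^2). *)
Definition qsystem (K : fieldType) (q : K) (M : nat) (u v : nat -> K) : Prop :=
  forall n, (n < M)%N ->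
    v n - q ^+ n * u n =
      off 1 (fun m => q ^+ m.+1 * u m) n - off 4 (fun m => q ^+ (3 * m + 7) * u m) n
    /\
    u n - v n =
      off 2 (fun m => q ^+ (m + 2) * v m) n + off 3 (fun m => q ^+ (2 * m + 3) * u m) n.

Lemma offZ (K : fieldType) n (c : K) w (u : nat -> K) : c * off w u n = off w (fun l => c * u l) n.
Proof. by rewrite /off; case: ifP; rewrite ?mulr0. Qed.

Lemma eq_off_fun (K : fieldType) n w (u v : nat -> K) : u =1 v -> off w u n = off w v n.
Proof. by rewrite /off => ->. Qed.

Lemma eq_off (K : fieldType) w (u u' : nat -> K) n :
  (0 < w)%N -> (forall m, (m < n)%N -> u m = u' m) -> off w u n = off w u' n.
Proof. by rewrite /off => w0 e; case: ifP => // lewn; apply: e; lia. Qed.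

(** Adding the two equations expresses (1 - q^n) u_n by earlier coefficients, which
    determines u_n for n > 0; either equation then determines v_n. *)
Lemma qsystem_uniq (K : fieldType) (q : K) M u v u' v' :
  (forall k, q ^+ k.+1 != 1) ->
  qsystem q M u v -> qsystem q M u' v' -> u 0%N = u' 0%N ->
  forall n, (n < M)%N -> u n = u' n /\ v n = v' n.
Proof.
move=> q_not_root s s' e0; elim/ltn_ind => n IH ltnM.
have eu m : (m < n)%N -> u m = u' m by move=> lt; case: (IH m lt (ltn_trans lt ltnM)).
have ev m : (m < n)%N -> v m = v' m by move=> lt; case: (IH m lt (ltn_trans lt ltnM)).
have [s1 s2] := s n ltnM; have [s1' s2'] := s' n ltnM.
have E1 : v n - q ^+ n * u n = v' n - q ^+ n * u' n.
  rewrite s1 s1'; congr (_ - _); apply: eq_off => // m lt; by rewrite eu.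
have E2 : u n - v n = u' n - v' n.
  by rewrite s2 s2'; congr (_ + _); apply: eq_off => // m lt; rewrite ?eu ?ev.
have eun : u n = u' n.
  case: n => [//|n] in {IH ltnM eu ev s1 s2 s1' s2'} E1 E2 *.
  have n0 : 1 - q ^+ n.+1 != 0 by rewrite subr_eq0 eq_sym.
  apply: (mulfI n0); rewrite !mulrBl !mul1r.
  by rewrite -(subrKA (v n.+1)) E1 E2 subrKA.
by split=> //; move: E2; rewrite eun => /addrI /oppr_inj.
Qed.

(** * Contiguous relations between the triple series *)

Lemma qpochS (A : pzRingType) (a p : A) n :
  qpoch a p n.+1 = qpoch a p n * (1 - a * p ^+ n).
Proof. exact: big_ord_recr. Qed.

Section Recurrences.
Variables (K : fieldType) (q : K).
Hypothesis q_not_root : forall k, q ^+ k.+1 != 1.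

(** The factor 1 - q^(r(m+1)) that comes out of the difference is the last factor
    of (q^r;q^r)_{m+1}, and cancels.  The three versions differ in the position of that factor. *)
Lemma qpochB_cancel1 r m e e' f a (D E : K) :
  (0 < r)%N -> e' = (e + r * m.+1)%N -> e = (a + f)%N ->
  q ^+ e / (qpoch (q ^+ r) (q ^+ r) m.+1 * D * E)
    - q ^+ e' / (qpoch (q ^+ r) (q ^+ r) m.+1 * D * E)
  = q ^+ a * (q ^+ f / (qpoch (q ^+ r) (q ^+ r) m * D * E)).
Proof.
move=> r0 -> ->; rewrite qpochS -exprS -exprM.
have n0 : 1 - q ^+ (r * m.+1) != 0.
  by rewrite subr_eq0 eq_sym; case: r r0 => // r _; exact: q_not_root.
rewrite -mulrBl !exprD -{1}[q ^+ a * _]mulr1 -mulrBr -!mulrA.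
by rewrite [_ * (_ * (D * E))]mulrCA (invfM (1 - _)) mulVKf.
Qed.

Lemma qpochB_cancel2 r m e e' f a (D E : K) :
  (0 < r)%N -> e' = (e + r * m.+1)%N -> e = (a + f)%N ->
  q ^+ e / (D * qpoch (q ^+ r) (q ^+ r) m.+1 * E)
    - q ^+ e' / (D * qpoch (q ^+ r) (q ^+ r) m.+1 * E)
  = q ^+ a * (q ^+ f / (D * qpoch (q ^+ r) (q ^+ r) m * E)).
Proof. by rewrite ![D * _]mulrC; exact: qpochB_cancel1. Qed.

Lemma qpochB_cancel3 r m e e' f a (D E : K) :
  (0 < r)%N -> e' = (e + r * m.+1)%N -> e = (a + f)%N ->
  q ^+ e / (D * E * qpoch (q ^+ r) (q ^+ r) m.+1)
    - q ^+ e' / (D * E * qpoch (q ^+ r) (q ^+ r) m.+1)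
  = q ^+ a * (q ^+ f / (D * E * qpoch (q ^+ r) (q ^+ r) m)).
Proof. by rewrite ![_ * E * _]mulrAC; exact: qpochB_cancel2. Qed.

(** Degree in x, quadratic exponent of q, and summand without its power of x, for
    the series H(a,b,c): a, b, c are the extra linear exponents of q. *)
Definition hdeg (i j k : nat) : nat := (i + 2 * j + 2 * k)%N.
Definition hquad (i j k : nat) : nat := ((i + j) ^ 2 + (j + k) ^ 2 + k ^ 2)%N.
Definition hterm (a b c i j k : nat) : K :=
  q ^+ (hquad i j k + a * i + b * j + c * k)
  / (qpoch q q i * qpoch (q ^+ 2) (q ^+ 2) j * qpoch (q ^+ 2) (q ^+ 2) k).

(** The same for the series F(a,b,c). *)
Definition fdeg (i j k : nat) : nat := (3 * i + 2 * j + k)%N.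
Definition fquad (i j k : nat) : nat := (i ^ 2 + (i + j) ^ 2 + (i + j + k) ^ 2)%N.
Definition fterm (a b c i j k : nat) : K :=
  q ^+ (fquad i j k + a * i + b * j + c * k)
  / (qpoch q q i * qpoch q q j * qpoch q q k).

(** Substituting x q^m for x turns F(a,b,c) into F(3m+a,2m+b,m+c), and H(a,b,c)
    into H(m+a,2m+b,2m+c). *)
Lemma fterm_shift M n m a b c w :
  xcoef M fdeg (fterm (3 * m + a) (2 * m + b) (m + c)) w n
  = off w (fun l => q ^+ (m * l) * xcoef M fdeg (fterm a b c) 0 l) n.
Proof.
rewrite /off -xcoef_qshift; apply: eq_xcoef => i j k.
by rewrite /fterm mulrA -exprD; congr (_ ^+ _ / _); rewrite /fdeg; lia.
Qed.

Lemma hterm_shift M n m a b c w :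
  xcoef M hdeg (hterm (m + a) (2 * m + b) (2 * m + c)) w n
  = off w (fun l => q ^+ (m * l) * xcoef M hdeg (hterm a b c) 0 l) n.
Proof.
rewrite /off -xcoef_qshift; apply: eq_xcoef => i j k.
by rewrite /hterm mulrA -exprD; congr (_ ^+ _ / _); rewrite /hdeg; lia.
Qed.

Section Relations.
Variables (M n : nat).
Hypothesis ltnM : (n < M)%N.
Local Notation F a b c := (fun w => xcoef M fdeg (fterm a b c) w n).
Local Notation H a b c := (fun w => xcoef M hdeg (hterm a b c) w n).

(** H(a,b,c) - H(a+1,b,c) = x q^(a+1) H(a+2,b+2,c).  In the next five lemmas the
    exponents come in the same way from the increments of [hquad], [hdeg],
    [fquad] and [fdeg] when one index is increased by 1.  For H, the exponents b
    and c increase by 2 because the denominators in j and k have base q^2. *)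
Lemma hterm_rec_i a b c w :
  H a b c w - H a.+1 b c w = q ^+ a.+1 * H (a + 2) (b + 2) c (w + 1)%N.
Proof.
apply: xcoefB_shift1; first exact: ltnM.
- by rewrite /hdeg; lia.
- by rewrite /hdeg; lia.
- by move=> j k; rewrite /hterm; congr (_ ^+ _ / _); rewrite /hquad; lia.
- by move=> i j k; apply: (@qpochB_cancel1 1) => //; rewrite /hquad; lia.
Qed.

Lemma hterm_rec_j a b c w :
  H a b c w - H a b.+2 c w = q ^+ b.+2 * H (a + 2) (b + 4) (c + 2) (w + 2)%N.
Proof.
apply: xcoefB_shift2; first exact: ltnM.
- by rewrite /hdeg; lia.
- by rewrite /hdeg; lia.
- by move=> j k; rewrite /hterm; congr (_ ^+ _ / _); rewrite /hquad; lia.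
- by move=> i j k; apply: (@qpochB_cancel2 2) => //; rewrite /hquad; lia.
Qed.

Lemma hterm_rec_k a b c w :
  H a b c w - H a b c.+2 w = q ^+ c.+2 * H a (b + 2) (c + 4) (w + 2)%N.
Proof.
apply: xcoefB_shift3; first exact: ltnM.
- by rewrite /hdeg; lia.
- by rewrite /hdeg; lia.
- by move=> j k; rewrite /hterm; congr (_ ^+ _ / _); rewrite /hquad; lia.
- by move=> i j k; apply: (@qpochB_cancel3 2) => //; rewrite /hquad; lia.
Qed.

Lemma fterm_rec_i a b c w :
  F a b c w - F a.+1 b c w = q ^+ (a + 3) * F (a + 6) (b + 4) (c + 2) (w + 3)%N.
Proof.
apply: xcoefB_shift1; first exact: ltnM.
- by rewrite /fdeg; lia.
- by rewrite /fdeg; lia.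
- by move=> j k; rewrite /fterm; congr (_ ^+ _ / _); rewrite /fquad; lia.
- by move=> i j k; apply: (@qpochB_cancel1 1) => //; rewrite /fquad; lia.
Qed.

Lemma fterm_rec_j a b c w :
  F a b c w - F a b.+1 c w = q ^+ (b + 2) * F (a + 4) (b + 4) (c + 2) (w + 2)%N.
Proof.
apply: xcoefB_shift2; first exact: ltnM.
- by rewrite /fdeg; lia.
- by rewrite /fdeg; lia.
- by move=> j k; rewrite /fterm; congr (_ ^+ _ / _); rewrite /fquad; lia.
- by move=> i j k; apply: (@qpochB_cancel2 1) => //; rewrite /fquad; lia.
Qed.

Lemma fterm_rec_k a b c w :
  F a b c w - F a b c.+1 w = q ^+ (c + 1) * F (a + 2) (b + 2) (c + 2) (w + 1)%N.
Proof.
apply: xcoefB_shift3; first exact: ltnM.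
- by rewrite /fdeg; lia.
- by rewrite /fdeg; lia.
- by move=> j k; rewrite /fterm; congr (_ ^+ _ / _); rewrite /fquad; lia.
- by move=> i j k; apply: (@qpochB_cancel3 1) => //; rewrite /fquad; lia.
Qed.

(** F(a,1+2s,s) - F(a,2+2s,1+s) = x q^(1+s) F(a+2,3+2s,1+s).  The relations
    for j and k reduce it to the same relation for (a+2, s+1) multiplied by x;
    hence the induction on [n - w]. *)
Lemma fterm_rec_jk a s w :
  F a (1 + 2 * s) s w - F a (2 + 2 * s) (1 + s) w
  = q ^+ (1 + s) * F (2 + a) (3 + 2 * s) (1 + s) (1 + w)%N.
Proof.
have [m] : exists m, (n < w + m)%N by exists n.+1; lia.
elim: m a s w => [|m IH] a s w lt.
  by rewrite !(@xcoef_gt K M) ?subr0 ?mulr0 //; lia.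
have r2 : F a (1 + 2 * s) s w - F a (2 + 2 * s) s w
    = q ^+ (3 + 2 * s) * F (4 + a) (5 + 2 * s) (2 + s) (2 + w)%N.
  apply: etrans (fterm_rec_j _ _ _ _) _.
  by congr (_ ^+ _ * xcoef _ _ (fterm _ _ _) _ _); lia.
have r3 : F a (2 + 2 * s) s w - F a (2 + 2 * s) (1 + s) w
    = q ^+ (1 + s) * F (2 + a) (4 + 2 * s) (2 + s) (1 + w)%N.
  apply: etrans (fterm_rec_k _ _ _ _) _.
  by congr (_ ^+ _ * xcoef _ _ (fterm _ _ _) _ _); lia.
have r : F (2 + a) (3 + 2 * s) (1 + s) (1 + w)%N - F (2 + a) (4 + 2 * s) (2 + s) (1 + w)%N
    = q ^+ (2 + s) * F (4 + a) (5 + 2 * s) (2 + s) (2 + w)%N.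
  have := IH (2 + a)%N (1 + s)%N (1 + w)%N.
  rewrite (_ : 2 * (1 + s) = 2 + 2 * s)%N; last by lia.
  by apply; lia.
rewrite -(subrKA (F a (2 + 2 * s) s w)) r2 r3.
rewrite {1}(_ : 3 + 2 * s = (1 + s) + (2 + s))%N; last by lia.
by rewrite exprD -mulrA -r -mulrDr subrK.
Qed.

(** F(2+3s,1+2s,s) - F(3+3s,2+2s,1+s) = x q^(1+s) F(4+3s,2+2s,1+s) and
    F(1+3s,2s,s) - F(2+3s,1+2s,s) = x^2 q^(2+2s) F(5+3s,3+2s,1+s), by a joint
    induction on [n - w]: the first relation for s uses the second one for s+1
    multiplied by x, and the second one for s uses the first one for s+1
    multiplied by x^2. *)
Lemma fterm_rec_ijk s w :
  (F (2 + 3 * s) (1 + 2 * s) s w - F (3 + 3 * s) (2 + 2 * s) (1 + s) w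
  = q ^+ (1 + s) * F (4 + 3 * s) (2 + 2 * s) (1 + s) (1 + w)%N) /\
  (F (1 + 3 * s) (2 * s) s w - F (2 + 3 * s) (1 + 2 * s) s w
  = q ^+ (2 + 2 * s) * F (5 + 3 * s) (3 + 2 * s) (1 + s) (2 + w)%N).
Proof.
have [m] : exists m, (n < w + m)%N by exists n.+1; lia.
elim: m s w => [|m IH] s w lt.
  by rewrite !(@xcoef_gt K M) ?subr0 ?mulr0 //; lia.
have P s' w' : (n < w' + m.+1)%N ->
  (F (1 + 3 * s') (2 * s') s' w' - F (2 + 3 * s') (1 + 2 * s') s' w'
  = q ^+ (2 + 2 * s') * F (5 + 3 * s') (3 + 2 * s') (1 + s') (2 + w')%N).
  move=> lt'.
  have r1 : F (1 + 3 * s') (2 * s') s' w' - F (2 + 3 * s') (2 * s') s' w'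
      = q ^+ (4 + 3 * s') * F (7 + 3 * s') (4 + 2 * s') (2 + s') (3 + w')%N.
    apply: etrans (fterm_rec_i _ _ _ _) _.
    by congr (_ ^+ _ * xcoef _ _ (fterm _ _ _) _ _); lia.
  have r2 : F (2 + 3 * s') (2 * s') s' w' - F (2 + 3 * s') (1 + 2 * s') s' w'
      = q ^+ (2 + 2 * s') * F (6 + 3 * s') (4 + 2 * s') (2 + s') (2 + w')%N.
    apply: etrans (fterm_rec_j _ _ _ _) _.
    by congr (_ ^+ _ * xcoef _ _ (fterm _ _ _) _ _); lia.
  have r : F (5 + 3 * s') (3 + 2 * s') (1 + s') (2 + w')%N
        - F (6 + 3 * s') (4 + 2 * s') (2 + s') (2 + w')%N
      = q ^+ (2 + s') * F (7 + 3 * s') (4 + 2 * s') (2 + s') (3 + w')%N.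
    have [|+ _] := IH (1 + s')%N (2 + w')%N; first by lia.
    rewrite (_ : 2 * (1 + s') = 2 + 2 * s')%N; last by lia.
    by rewrite (_ : 3 * (1 + s') = 3 + 3 * s')%N; last by lia.
  rewrite -(subrKA (F (2 + 3 * s') (2 * s') s' w')) r1 r2.
  rewrite (_ : 4 + 3 * s' = (2 + 2 * s') + (2 + s'))%N; last by lia.
  by rewrite exprD -mulrA -r -mulrDr subrK.
split; last exact: P.
have r1 : F (2 + 3 * s) (1 + 2 * s) s w - F (3 + 3 * s) (1 + 2 * s) s w
    = q ^+ (5 + 3 * s) * F (8 + 3 * s) (5 + 2 * s) (2 + s) (3 + w)%N.
  apply: etrans (fterm_rec_i _ _ _ _) _.
  by congr (_ ^+ _ * xcoef _ _ (fterm _ _ _) _ _); lia.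
have r2 : F (3 + 3 * s) (1 + 2 * s) s w - F (3 + 3 * s) (2 + 2 * s) (1 + s) w
    = q ^+ (1 + s) * F (5 + 3 * s) (3 + 2 * s) (1 + s) (1 + w)%N.
  by rewrite fterm_rec_jk.
have r : F (4 + 3 * s) (2 + 2 * s) (1 + s) (1 + w)%N
      - F (5 + 3 * s) (3 + 2 * s) (1 + s) (1 + w)%N
    = q ^+ (4 + 2 * s) * F (8 + 3 * s) (5 + 2 * s) (2 + s) (3 + w)%N.
  have := P (1 + s)%N (1 + w)%N.
  rewrite (_ : 2 * (1 + s) = 2 + 2 * s)%N; last by lia.
  rewrite (_ : 3 * (1 + s) = 3 + 3 * s)%N; last by lia.
  by apply; lia.
rewrite -(subrKA (F (3 + 3 * s) (1 + 2 * s) s w)) r1 r2.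
rewrite {1}(_ : 5 + 3 * s = (1 + s) + (4 + 2 * s))%N; last by lia.
by rewrite exprD -mulrA -r -mulrDr subrK.
Qed.
End Relations.

Lemma fterm_qsystem M :
  qsystem q M (xcoef M fdeg (fterm 0 0 0) 0) (xcoef M fdeg (fterm 2 1 0) 0).
Proof.
move=> n ltnM; split.
  have -> : q ^+ n * xcoef M fdeg (fterm 0 0 0) 0 n = xcoef M fdeg (fterm 3 2 1) 0 n.
    by rewrite (fterm_shift M n 1 0 0 0 0) /off /= subn0 mul1n.
  have [-> _] := fterm_rec_ijk ltnM 0 0.
  have r1 := fterm_rec_i ltnM 3 2 1 1.
  (* Eliminate F(4,2,1), which is not a q-shift of F(0,0,0), in favour of F(3,2,1)
     and F(9,6,3), which are. *)
  rewrite (_ : xcoef M fdeg (fterm 4 2 1) 1 n = xcoef M fdeg (fterm 3 2 1) 1 n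
    - q ^+ 6 * xcoef M fdeg (fterm 9 6 3) 4 n); last by rewrite -r1 subKr.
  rewrite (fterm_shift M n 1 0 0 0 1) (fterm_shift M n 3 0 0 0 4) mulrBr mulrA.
  rewrite -exprD !offZ.
  by congr (_ - _); apply: eq_off_fun => m; rewrite mulrA -exprD; congr (_ ^+ _ * _); lia.
have [_ r0] := fterm_rec_ijk ltnM 0 0.
rewrite -(subrKA (xcoef M fdeg (fterm 1 0 0) 0 n)) r0 (fterm_rec_i ltnM 0 0 0 0) addrC.
rewrite (fterm_shift M n 1 2 1 0 2) (fterm_shift M n 2 0 0 0 3) !offZ.
by congr (_ + _); apply: eq_off_fun => m; rewrite mulrA -exprD; congr (_ ^+ _ * _); lia.
Qed.

Lemma hterm_qsystem M :
  qsystem q M (xcoef M hdeg (hterm 0 1 0) 0) (xcoef M hdeg (hterm 0 1 2) 0).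
Proof.
move=> n ltnM; split.
  have -> : q ^+ n * xcoef M hdeg (hterm 0 1 0) 0 n = xcoef M hdeg (hterm 1 3 2) 0 n.
    by rewrite (hterm_shift M n 1 0 1 0 0) /off /= subn0 mul1n.
  rewrite -(subrKA (xcoef M hdeg (hterm 1 1 2) 0 n)).
  rewrite (hterm_rec_i ltnM 0 1 2 0) (hterm_rec_j ltnM 1 1 2 0).
  have r1 := hterm_rec_i ltnM 1 3 2 1.
  have r3 := hterm_rec_k ltnM 3 5 2 2.
  (* The two terms H(3,5,2) that arise from H(2,3,2) and H(3,5,4) cancel. *)
  rewrite (_ : xcoef M hdeg (hterm 2 3 2) 1 n = xcoef M hdeg (hterm 1 3 2) 1 n
    - q ^+ 2 * xcoef M hdeg (hterm 3 5 2) 2 n); last by rewrite -r1 subKr.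
  rewrite (_ : xcoef M hdeg (hterm 3 5 4) 2 n = xcoef M hdeg (hterm 3 5 2) 2 n
    - q ^+ 4 * xcoef M hdeg (hterm 3 7 6) 4 n); last by rewrite -r3 subKr.
  rewrite !mulrBr [q ^+ 1 * (_ * _)]mulrA [q ^+ 3 * (_ * _)]mulrA -!exprD addrA subrK.
  rewrite (hterm_shift M n 1 0 1 0 1) (hterm_shift M n 3 0 1 0 4) !offZ.
  by congr (_ - _); apply: eq_off_fun => m; rewrite mulrA -exprD; congr (_ ^+ _ * _); lia.
rewrite (hterm_rec_k ltnM 0 1 0 0).
have r1 := hterm_rec_i ltnM 0 3 4 2.
rewrite (_ : xcoef M hdeg (hterm 0 3 4) 2 n = xcoef M hdeg (hterm 1 3 4) 2 n
    + q ^+ 1 * xcoef M hdeg (hterm 2 5 4) 3 n); last by rewrite -r1 addrC subrK.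
rewrite mulrDr mulrA -exprD (hterm_shift M n 1 0 1 2 2) (hterm_shift M n 2 0 1 0 3) !offZ.
by congr (_ + _); apply: eq_off_fun => m; rewrite mulrA -exprD; congr (_ ^+ _ * _); lia.
Qed.

(** Equality of all coefficients, hence the identities between formal power series
    in x. *)
Lemma xcoef_hterm_fterm M n : (n < M)%N ->
  xcoef M hdeg (hterm 0 1 0) 0 n = xcoef M fdeg (fterm 0 0 0) 0 n /\
  xcoef M hdeg (hterm 0 1 2) 0 n = xcoef M fdeg (fterm 2 1 0) 0 n.
Proof.
move=> ltnM; apply: (qsystem_uniq q_not_root (@hterm_qsystem M) (@fterm_qsystem M)) => //.
rewrite !xcoef00 //; try by move: ltnM; case: (M).
- by rewrite /fterm /hterm /qpoch !big_ord0 !mulr1.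
- by move=> i j k; rewrite /fdeg; lia.
- by move=> i j k; rewrite /hdeg; lia.
Qed.
End Recurrences.

(** * Unconditional convergence *)

#[local] Existing Instance totally_filter.

Section RealNets.
Variables (R : realType) (I : choiceType).
Implicit Types (g : I -> R) (A B : {fset I}).

Lemma partial_sumE (V : zmodType) (f : I -> V) A :
  partial_sum f A = \sum_(i <- A) f i.
Proof. by rewrite /partial_sum big_seq_fsetE. Qed.

Lemma partial_sum_le g A B :
  (forall i, 0 <= g i) -> (A `<=` B)%fset -> partial_sum g A <= partial_sum g B.
Proof.
move=> g0 AB; rewrite !partial_sumE (big_fsetID _ (mem A) B) /=.
have -> : [fset x in B | x \in A]%fset = A.
  apply/fsetP => t; rewrite !inE /= andbC.
  by case tA: (t \in A) => //=; apply: (fsubsetP AB).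
by rewrite lerDl; apply: sumr_ge0.
Qed.

Lemma cvg_partial_sum_ge0 g c : (forall i, 0 <= g i) ->
  (forall A, partial_sum g A <= c) -> cvg (partial_sum g @ totally).
Proof.
move=> g0 gc; pose E := range (partial_sum g).
have supE : has_sup E.
  by split; [exists (partial_sum g fset0), fset0 | exists c => _ [A _ <-]].
apply/cvg_ex; exists (sup E); apply/cvgrPdist_le => e e0.
have [_ [A _ <-] ltA] := sup_adherent e0 supE.
exists A => // B /= AB; rewrite ger0_norm.
  rewrite lerBlDr -lerBlDl (le_trans (ltW ltA)) //.
  exact: partial_sum_le.
by rewrite subr_ge0; apply: sup_upper_bound => //; exists B.
Qed.

Lemma cvg_partial_sum_abs g h c : (forall i, `|g i| <= h i) ->
  (forall A, partial_sum h A <= c) -> cvg (partial_sum g @ totally).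
Proof.
move=> gh hc; have h0 i : 0 <= h i by rewrite (le_trans _ (gh i)).
have [h1 h2] : (forall i, 0 <= h i + g i) /\ (forall i, h i + g i <= h i + h i).
  by split=> i; have := gh i; rewrite ler_norml => /andP[? ?]; lra.
(* g = (h + g) - h is a difference of nonnegative families. *)
have -> : partial_sum g = partial_sum (fun i => h i + g i) \- partial_sum h.
  apply/funext => A /=; rewrite !partial_sumE big_split /=.
  by rewrite addrAC subrr add0r.
apply: is_cvgB; last exact: (cvg_partial_sum_ge0 h0 hc).
apply: (@cvg_partial_sum_ge0 _ (c + c)) => // A.
rewrite (le_trans _ (lerD (hc A) (hc A))) // !partial_sumE -big_split.
exact: ler_sum.
Qed.
End RealNets.

Section ComplexNets.
Variables (R : realType) (I : choiceType).

Lemma normc_real (x : R) : `|x%:C| = `|x|%:C :> R[i].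
Proof. by rewrite normc_def /= expr0n addr0 sqrtr_sqr. Qed.

Lemma ler_Re_Im (z : R[i]) (b : R) :
  `|z| <= b%:C -> `|complex.Re z| <= b /\ `|complex.Im z| <= b.
Proof.
rewrite normc_def lecR => le; split; apply: le_trans le; rewrite -sqrtr_sqr;
  by apply: ler_wsqrtr; rewrite ?lerDl ?lerDr sqr_ge0.
Qed.

(** The norm in [R[i]] takes values in [R[i]]; hence the embedded majorant.
    Convergence is obtained from that of the real and imaginary parts. *)
Lemma cvg_partial_sum_complex (f : I -> R[i]^o) (h : I -> R) c :
  (forall i, `|f i : R[i]| <= (h i)%:C) ->
  (forall A, partial_sum h A <= c) -> cvg (partial_sum f @ totally).
Proof.
move=> fh hc.
have /cvg_ex[/= a ca] : cvg (partial_sum (fun i => complex.Re (f i)) @ totally).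
  by apply: cvg_partial_sum_abs hc => i; have [] := ler_Re_Im (fh i).
have /cvg_ex[/= b cb] : cvg (partial_sum (fun i => complex.Im (f i)) @ totally).
  by apply: cvg_partial_sum_abs hc => i; have [] := ler_Re_Im (fh i).
apply/cvg_ex; exists (a%:C + 'i * b%:C : R[i]^o); apply/cvgrPdist_le => e e0.
have [d d0 ->] : exists2 d : R, 0 < d & e = d%:C.
  have re : e \is Num.real by apply: gtr0_real.
  by exists (complex.Re e); [rewrite -ltcR RRe_real | rewrite RRe_real].
have d20 : 0 < d / 2 by rewrite divr_gt0.
move/cvgrPdist_le/(_ _ d20): ca => ca; move/cvgrPdist_le/(_ _ d20): cb => cb.
apply: filterS2 ca cb => A la lb.
have -> : partial_sum f A = (partial_sum (fun i => complex.Re (f i)) A)%:C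
    + 'i * (partial_sum (fun i => complex.Im (f i)) A)%:C :> R[i].
  rewrite !partial_sumE !rmorph_sum mulr_sumr -big_split.
  by apply: eq_bigr => i _; exact: complexE.
rewrite opprD addrACA -mulrBr -!rmorphB (le_trans (ler_normD _ _)) //.
rewrite normrM (normc_def 'i) /= expr0n expr1n add0r sqrtr1 mul1r.
by rewrite !normc_real -rmorphD lecR [leRHS]splitr lerD.
Qed.

(** Two unconditionally convergent sums agree if their partial sums agree along
    two sequences of finite sets that exhaust the index sets. *)
Lemma eq_sum_exhaustion (J : choiceType) (f : I -> R[i]^o) (g : J -> R[i]^o)
    (A : nat -> {fset I}) (B : nat -> {fset J}) :
  A @ \oo --> totally -> B @ \oo --> totally ->
  cvg (partial_sum f @ totally) -> cvg (partial_sum g @ totally) ->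
  (forall N, partial_sum f (A N) = partial_sum g (B N)) ->
  sum f = sum g.
Proof.
move=> cA cB cf cg efg.
have fA : partial_sum f (A N) @[N --> \oo] --> sum f by apply: cvg_comp cA cf.
have gB : partial_sum g (B N) @[N --> \oo] --> sum g by apply: cvg_comp cB cg.
rewrite (funext efg) in fA.
exact: (cvg_unique (@norm_hausdorff _ _) fA gB).
Qed.
End ComplexNets.

(** * Exhaustion by the degree and termwise bounds *)

(** The indices of degree less than [N].  The box of side [N] contains all of them
    when [i + j + k <= d i j k]. *)
Definition degset (d : nat -> nat -> nat -> nat) (N : nat) :
    {fset nat * nat * nat} :=
  seq_fset tt [seq t <- [seq (p, k) | p <- [seq (i, j) | i <- iota 0 N, j <- iota 0 N],
                                      k <- iota 0 N]
              | (d t.1.1 t.1.2 t.2 < N)%N].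

Section DegreeSets.
Variable d : nat -> nat -> nat -> nat.
Hypothesis led : forall i j k, (i + j + k <= d i j k)%N.

Lemma in_degset N t : (t \in degset d N) = (d t.1.1 t.1.2 t.2 < N)%N.
Proof.
case: t => [[i j] k]; rewrite seq_fsetE mem_filter /= andbC.
case: ltnP => [lt|_]; last by rewrite andbF.
have := led i j k => le; rewrite andbT.
by do 2![apply: allpairs_f; rewrite ?mem_iota //; try lia].
Qed.

Lemma cvg_degset : degset d @ \oo --> totally.
Proof.
move=> P [A _ AP]; exists (\max_(t <- A) d t.1.1 t.1.2 t.2).+1 => // N /= ltN.
apply: AP => /=; apply/fsubsetP => t tA; rewrite in_degset (leq_trans _ ltN) // ltnS.
exact: (@leq_bigmax_seq _ (enum_fset A) xpredT (fun t => d t.1.1 t.1.2 t.2)).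
Qed.

Lemma partial_sum_degset (V : zmodType) (f : nat * nat * nat -> V) N :
  partial_sum f (degset d N) = \sum_(i < N) \sum_(j < N) \sum_(k < N)
    if (d i j k < N)%N then f (val i, val j, val k) else 0.
Proof.
rewrite partial_sumE (perm_big _ (seq_fset_perm _ _)) undup_id; last first.
  apply: filter_uniq; apply: allpairs_uniq => [||[? ?] [? ?] _ _ [-> ->]] //;
    last exact: iota_uniq.
  by apply: allpairs_uniq => [||[? ?] [? ?] _ _ [-> ->]] //; exact: iota_uniq.
rewrite big_filter big_mkcond big_allpairs big_allpairs /=.
have big_iota (F : nat -> V) : \sum_(i <- iota 0 N) F i = \sum_(i < N) F i.
  by rewrite -(big_mkord predT) /index_iota subn0.
rewrite big_iota; apply: eq_bigr => i _; rewrite big_iota; apply: eq_bigr => j _.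
by rewrite big_iota.
Qed.

(** The partial sum over degrees below [N] is the truncation of the power series. *)
Lemma partial_sum_xcoef (K : fieldType) (x : K) (T : nat -> nat -> nat -> K)
    (f : nat * nat * nat -> K) N :
  (forall i j k, f (i, j, k) = x ^+ d i j k * T i j k) ->
  partial_sum f (degset d N) = \sum_(n < N) x ^+ n * xcoef N d T 0 n.
Proof.
move=> fE; rewrite partial_sum_degset /xcoef.
under [RHS]eq_bigr => n _ do rewrite mulr_sumr.
rewrite [RHS]exchange_big; apply: eq_bigr => i _ /=.
under [RHS]eq_bigr => n _ do rewrite mulr_sumr.
rewrite [RHS]exchange_big; apply: eq_bigr => j _ /=.
under [RHS]eq_bigr => n _ do rewrite mulr_sumr.
rewrite [RHS]exchange_big; apply: eq_bigr => k _ /=; rewrite fE.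
case: ltnP => [lt|le].
  rewrite (bigD1 (Ordinal lt)) //= add0n eqxx big1 ?addr0 // => n.
  rewrite -val_eqE /= => nd; rewrite eq_sym (negbTE nd) mulr0 //.
rewrite big1 // => n _; rewrite add0n gtn_eqF ?mulr0 //.
exact: leq_trans (ltn_ord n) le.
Qed.
End DegreeSets.

Lemma partial_sum_geometric (R : realType) (c : R) (A : {fset nat * nat * nat}) :
  0 <= c ->
  partial_sum (fun t => c * 2^-1 ^+ (t.1.1 + t.1.2 + t.2)) A <= c * 8.
Proof.
move=> c0; pose d i j k := (i + j + k)%N.
have [N _ /(_ N (leqnn N)) /= AN] : \forall N \near \oo, (A `<=` degset d N)%fset.
  have cd : degset d @ \oo --> totally by apply: cvg_degset.
  by apply: (cd [set B | (A `<=` B)%fset]); exists A.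
apply: le_trans (partial_sum_le _ AN) _ => [t|].
  by rewrite mulr_ge0 // exprn_ge0 // invr_ge0.
rewrite partial_sum_degset //.
pose s := \sum_(i < N) 2^-1 ^+ i : R.
have s0 : 0 <= s by apply: sumr_ge0 => i _; rewrite exprn_ge0 // invr_ge0.
have s2 : s <= 2.
  suff -> : s = 2 - 2 * 2^-1 ^+ N.
    by rewrite gerBl mulr_ge0 // exprn_ge0 // invr_ge0.
  rewrite /s; elim: N {AN s s0} => [|N IH]; first by rewrite big_ord0 expr0 mulr1 subrr.
  by rewrite big_ord_recr /= IH exprS; field.
apply: (@le_trans _ _ (c * s ^+ 3)); last first.
  by rewrite ler_wpM2l // (le_trans (lerXn2r _ _ _ s2)) ?nnegrE // -natrX.
rewrite !exprS expr0 mulr1 mulr_suml mulr_sumr; apply: ler_sum => i _.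
rewrite mulr_suml mulr_sumr mulr_sumr; apply: ler_sum => j _.
rewrite !mulr_sumr; apply: ler_sum => k _ /=.
case: ifP => _; first by rewrite !exprD !mulrA.
by rewrite !mulr_ge0 // exprn_ge0 // invr_ge0.
Qed.

Lemma gauss_le_geometric (R : realType) (r k : R) : 0 <= r < 1 -> 0 <= k ->
  exists2 c : R, 0 <= c & forall n, r ^+ (n ^ 2) * k ^+ n <= c * 2^-1 ^+ n.
Proof.
move=> /andP[r0 r1] k0; pose m := 2 * k + 1.
have m1 : 1 <= m by rewrite lerDr mulr_ge0.
have m0 : 0 < m by rewrite (lt_le_trans ltr01).
have r01 : `|r| < 1 by rewrite ger0_norm.
have im0 : 0 < m^-1 by rewrite invr_gt0.
have /cvgr0_norm_le/(_ _ im0)[N _ rN] := cvg_expr r01.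
(* With r^N m <= 1, the quantity (r^n m)^n is at most m^N for n <= N and at most 1
   for n >= N. *)
exists (m ^+ N) => [|n]; first by rewrite exprn_ge0 // ltW.
rewrite exprVn ler_pdivlMr ?exprn_gt0 // -mulrA -exprMn.
apply: (@le_trans _ _ (r ^+ (n ^ 2) * m ^+ n)).
  rewrite ler_wpM2l ?exprn_ge0 // lerXn2r ?nnegrE ?mulr_ge0 //.
  - exact: ltW.
  - by rewrite /m; lra.
case: (leqP n N) => [le|/ltnW le].
  rewrite -[leRHS]mul1r ler_pM ?exprn_ge0 ?exprn_ile1 ?(ltW r1) ?(ltW m0) //.
  exact: ler_weXn2l.
apply: (@le_trans _ _ 1); last exact: exprn_ege1.
rewrite -mulnn exprM -exprMn exprn_ile1 ?mulr_ge0 ?exprn_ge0 ?(ltW m0) //.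
have := rN n le; rewrite /= ger0_norm ?exprn_ge0 // => h.
by rewrite -ler_pdivlMr // div1r.
Qed.

Lemma norm_qpoch_ge (K : numFieldType) (a p r : K) n :
  `|a| <= r -> `|p| <= 1 -> r <= 1 -> (1 - r) ^+ n <= `|qpoch a p n|.
Proof.
move=> ar p1 r1; elim: n => [|n IH]; first by rewrite /qpoch big_ord0 normr1.
rewrite qpochS exprSr normrM ler_pM ?exprn_ge0 ?subr_ge0 //.
apply: (@le_trans _ _ (`|1| - `|a * p ^+ n|)); last exact: lerB_dist.
rewrite normr1 lerD2l lerN2 normrM normrX (le_trans _ ar) //.
by rewrite ler_piMr // exprn_ile1.
Qed.

(** As 1 - |q| is a lower bound for |1 - q^k| with k > 0, it is enough that the
    denominator be bounded below by a product of i + j + k such factors; a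
    summand is then at most the product over n = i, j, k of r^(n^2) kap^n, where
    r = |q| and kap = (1 + |x|)^3 / (1 - |q|). *)
Lemma summable3_qseries (R : realType) (q x : R[i]) (P : nat -> nat -> nat -> R[i])
    (e l : nat -> nat -> nat -> nat) :
  `|q| < 1 ->
  (forall i j k, i ^ 2 + j ^ 2 + k ^ 2 <= e i j k)%N ->
  (forall i j k, l i j k <= 3 * (i + j + k))%N ->
  (forall i j k, (1 - `|q|) ^+ (i + j + k) <= `|P i j k|) ->
  summable3 (fun i j k => q ^+ e i j k * x ^+ l i j k / P i j k).
Proof.
move=> q1 lee lel leP.
have [r rE] : exists r : R, `|q| = r%:C by exists (complex.Re `|q|); rewrite RRe_real.
have [y yE] : exists y : R, `|x| = y%:C by exists (complex.Re `|x|); rewrite RRe_real.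
have r0 : 0 <= r by rewrite -ler0c -rE.
have r1 : r < 1 by move: q1; rewrite rE -ltcR.
have y0 : 0 <= y by rewrite -ler0c -yE.
pose kap := (1 + y) ^+ 3 / (1 - r).
have s0 : 0 < 1 - r by rewrite subr_gt0.
have y1 : 0 <= 1 + y by rewrite addr_ge0 ?ler01.
have kap0 : 0 <= kap by apply: divr_ge0; [exact: exprn_ge0 | exact: ltW].
have r01 : 0 <= r < 1 by rewrite r0 r1.
have [c c0 hc] := gauss_le_geometric r01 kap0.
pose h (t : nat * nat * nat) := c ^+ 3 * 2^-1 ^+ (t.1.1 + t.1.2 + t.2).
apply: (@cvg_partial_sum_complex _ _ _ h (c ^+ 3 * 8)); last first.
  by move=> A; apply: partial_sum_geometric; rewrite exprn_ge0.
move=> [[i j] k]; rewrite /uncurry3 /h /=.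
rewrite !normrM !normrX normfV rE yE.
have p0 : 0 < (1 - r) ^+ (i + j + k) by rewrite exprn_gt0.
have leP' : ((1 - r) ^+ (i + j + k))%:C <= `|P i j k|.
  by have := leP i j k; rewrite rE rmorphXn rmorphB rmorph1.
have P0 : 0 < `|P i j k| by apply: lt_le_trans leP'; rewrite -[0]/(0%:C) ltcR.
have leV : `|P i j k|^-1 <= ((1 - r) ^- (i + j + k))%:C.
  by rewrite rmorphV ?unitfE ?gt_eqF //= lef_pV2 ?posrE // ltcR.
apply: (@le_trans _ _ (r ^+ e i j k * y ^+ l i j k * (1 - r) ^- (i + j + k))%:C).
  by rewrite !rmorphM !rmorphXn ler_wpM2l // mulr_ge0 // exprn_ge0 // ler0c.
rewrite lecR.
apply: (@le_trans _ _ ((r ^+ (i ^ 2) * kap ^+ i) * (r ^+ (j ^ 2) * kap ^+ j)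
    * (r ^+ (k ^ 2) * kap ^+ k))); last first.
  have g0 n : 0 <= r ^+ (n ^ 2) * kap ^+ n by rewrite mulr_ge0 // exprn_ge0.
  have -> : c ^+ 3 * 2^-1 ^+ (i + j + k)
    = (c * 2^-1 ^+ i) * (c * 2^-1 ^+ j) * (c * 2^-1 ^+ k) by rewrite !exprD; ring.
  by apply: ler_pM => //; [exact: mulr_ge0 | exact: ler_pM].
have -> : (r ^+ (i ^ 2) * kap ^+ i) * (r ^+ (j ^ 2) * kap ^+ j) * (r ^+ (k ^ 2) * kap ^+ k)
  = r ^+ (i ^ 2 + j ^ 2 + k ^ 2) * ((1 + y) ^+ (3 * (i + j + k)) * (1 - r) ^- (i + j + k)).
  by rewrite exprM -exprVn -exprMn !exprD /kap; ring.
rewrite -mulrA ler_pM ?mulr_ge0 ?invr_ge0 ?exprn_ge0 ?(ltW s0) //.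
  by apply: ler_wiXn2l => //; exact: ltW.
rewrite ler_wpM2r ?invr_ge0 ?exprn_ge0 ?(ltW s0) //.
apply: (@le_trans _ _ ((1 + y) ^+ l i j k)).
  by rewrite lerXn2r ?nnegrE ?addr_ge0 // lerDr.
by apply: ler_weXn2l => //; rewrite lerDl.
Qed.

(** * Summability and equality of the sums *)

Lemma expr_neq1 (K : numDomainType) (q : K) : `|q| < 1 -> forall k, q ^+ k.+1 != 1.
Proof.
move=> q1 k; apply/eqP => /(congr1 Num.norm); rewrite normrX normr1 => /eqP.
by rewrite lt_eqF // exprn_ilt1.
Qed.

(** Triple series with the same coefficients as power series in x have the same
    sum at x, even if they are graded by different degree functions. *)
Lemma eq_sum3_xcoef (R : realType) (x : R[i]) (d d' : nat -> nat -> nat -> nat)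
    (S T F G : nat -> nat -> nat -> R[i]) :
  (forall i j k, i + j + k <= d i j k)%N ->
  (forall i j k, i + j + k <= d' i j k)%N ->
  (forall i j k, F i j k = x ^+ d i j k * S i j k) ->
  (forall i j k, G i j k = x ^+ d' i j k * T i j k) ->
  summable3 F -> summable3 G ->
  (forall M n, (n < M)%N -> xcoef M d S 0 n = xcoef M d' T 0 n) ->
  eq_sum3 F G.
Proof.
move=> led led' FE GE sF sG eST; split=> //.
have cA : degset d @ \oo --> totally by exact: cvg_degset.
have cB : degset d' @ \oo --> totally by exact: cvg_degset.
apply: eq_sum_exhaustion cA cB sF sG _ => N.
rewrite (@partial_sum_xcoef d _ x S) //.
rewrite (@partial_sum_xcoef d' _ x T) //.
by apply: eq_bigr => n _; rewrite eST.
Qed.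

Lemma summable3_hterm (R : realType) (q x : R[i]) (e : nat -> nat -> nat -> nat) :
  `|q| < 1 -> (forall i j k, hquad i j k <= e i j k)%N ->
  summable3 (fun i j k : nat => q ^+ e i j k * x ^+ hdeg i j k
    / (qpoch q q i * qpoch (q ^+ 2) (q ^+ 2) j * qpoch (q ^+ 2) (q ^+ 2) k)).
Proof.
move=> q1 ee; have q2 : `|q ^+ 2| <= `|q|.
  by rewrite normrX expr2 ler_piMl // ltW.
apply: summable3_qseries => // i j k.
- by apply: leq_trans (ee i j k); rewrite /hquad; lia.
- by rewrite /hdeg; lia.
- by rewrite !exprD !normrM !ler_pM ?mulr_ge0 ?exprn_ge0 ?subr_ge0 ?norm_qpoch_ge
    // ?(le_trans q2) // ltW.
Qed.

Lemma summable3_fterm (R : realType) (q x : R[i]) (e : nat -> nat -> nat -> nat) :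
  `|q| < 1 -> (forall i j k, fquad i j k <= e i j k)%N ->
  summable3 (fun i j k : nat => q ^+ e i j k * x ^+ fdeg i j k
    / (qpoch q q i * qpoch q q j * qpoch q q k)).
Proof.
move=> q1 ee; apply: summable3_qseries => // i j k.
- by apply: leq_trans (ee i j k); rewrite /fquad; lia.
- by rewrite /fdeg; lia.
- by rewrite !exprD !normrM !ler_pM ?mulr_ge0 ?exprn_ge0 ?subr_ge0 ?norm_qpoch_ge // ltW.
Qed.

Theorem theorem1p3 (R : realType) (q x : R[i]) (hq : `|q| < 1) :
  eq_sum3
    (fun i j k : nat =>
       q ^+ ((i + j) ^ 2 + (j + k) ^ 2 + k ^ 2 + j)%N
         * x ^+ (i + 2 * j + 2 * k)%N
       / (qpoch q q i * qpoch (q ^+ 2) (q ^+ 2) j * qpoch (q ^+ 2) (q ^+ 2) k))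
    (fun i j k : nat =>
       q ^+ (i ^ 2 + (i + j) ^ 2 + (i + j + k) ^ 2)%N
         * x ^+ (3 * i + 2 * j + k)%N
       / (qpoch q q i * qpoch q q j * qpoch q q k))
  /\
  eq_sum3
    (fun i j k : nat =>
       q ^+ ((i + j) ^ 2 + (j + k) ^ 2 + k ^ 2 + j + 2 * k)%N
         * x ^+ (i + 2 * j + 2 * k)%N
       / (qpoch q q i * qpoch (q ^+ 2) (q ^+ 2) j * qpoch (q ^+ 2) (q ^+ 2) k))
    (fun i j k : nat =>
       q ^+ (i ^ 2 + (i + j) ^ 2 + (i + j + k) ^ 2 + 2 * i + j)%N
         * x ^+ (3 * i + 2 * j + k)%N
       / (qpoch q q i * qpoch q q j * qpoch q q k)).
Proof.
have q_neq1 := expr_neq1 hq.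
have ledh i j k : (i + j + k <= hdeg i j k)%N by rewrite /hdeg; lia.
have ledf i j k : (i + j + k <= fdeg i j k)%N by rewrite /fdeg; lia.
split.
- apply: (@eq_sum3_xcoef R x hdeg fdeg (hterm q 0 1 0) (fterm q 0 0 0)) => //.
  + move=> i j k; rewrite mulrAC mulrC; congr (_ * (_ ^+ _ / _)).
    by rewrite /hquad; lia.
  + move=> i j k; rewrite mulrAC mulrC; congr (_ * (_ ^+ _ / _)).
    by rewrite /fquad; lia.
  + by apply: summable3_hterm => // i j k; rewrite /hquad; lia.
  + by apply: summable3_fterm.
  + by move=> M n ltnM; case: (xcoef_hterm_fterm q_neq1 ltnM) => E _; exact: E.
- apply: (@eq_sum3_xcoef R x hdeg fdeg (hterm q 0 1 2) (fterm q 2 1 0)) => //.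
  + move=> i j k; rewrite mulrAC mulrC; congr (_ * (_ ^+ _ / _)).
    by rewrite /hquad; lia.
  + move=> i j k; rewrite mulrAC mulrC; congr (_ * (_ ^+ _ / _)).
    by rewrite /fquad; lia.
  + by apply: summable3_hterm => // i j k; rewrite /hquad; lia.
  + by apply: summable3_fterm => // i j k; rewrite /fquad; lia.
  + by move=> M n ltnM; case: (xcoef_hterm_fterm q_neq1 ltnM) => _ E; exact: E.
Qed.
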